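(* Let $f \in (0, \frac{1}{3})$ be a real number. Let $\pi\colon \mathbb{R}\to\mathbb{R}$ be the function that is periodic modulo $1$ and is given on $[0,1]$ by \[ \pi(x) = \begin{cases} \frac{1}{f} x & \text{if } 0 \leq x \leq f, \\ \frac{2}{1+2f} x & \text{if } f < x < \frac{1+f}{2}, \\ \frac{1}{2} & \text{if } x = \frac{1+f}{2}, \\ \frac{2}{1+2f} x - \frac{1}{1+2f} & \text{if } \frac{1+f}{2} < x < 1, \\ 0 & \text{if } x = 1. \end{cases} \] Then $\pi$ is an extreme function for the single-row Gomory--Johnson infinite group problem $R_f(\mathbb{R},\mathbb{Z})$.
   Context: Let $f\in\mathbb{R}\setminus\mathbb{Z}$. The single-row infinite group problem concerns functions $y\colon\mathbb{R}\to\mathbb{Z}_+$ (nonnegative integer values) of finite support satisfying $\sum_{r\in\mathbb{R}} r\,y(r)\equiv f \pmod 1$, i.e. $\sum_{r\in\mathbb{R}} r\,y(r) - f\in\mathbb{Z}$. Let $R_f(\mathbb{R},\mathbb{Z})$ denote the convex hull of the set of all such functions $y$ (its elements are functions $\mathbb{R}\to\mathbb{R}_+$). A valid function for $R_f(\mathbb{R},\mathbb{Z})$ is a nonnegative function $\pi\colon\mathbb{R}\to\mathbb{R}$ (that is, $\pi(r)\ge 0$ for all $r$) such that $\sum_{r\in\mathbb{R}}\pi(r)y(r)\ge 1$ for all $y\in R_f(\mathbb{R},\mathbb{Z})$ (equivalently, for all functions $y\colon\mathbb{R}\to\mathbb{Z}_+$ of finite support with $\sum_{r} r\,y(r)\equiv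 f\pmod 1$). A valid function $\pi$ is extreme if it is not a proper convex combination of other valid functions; that is, whenever $\pi=\frac12(\pi^1+\pi^2)$ with $\pi^1,\pi^2$ valid functions, then $\pi=\pi^1=\pi^2$. *)

(* Defs.v *)
From HB Require Import structures.
From mathcomp Require Import all_boot all_order all_algebra.
From mathcomp Require Import all_classical all_reals all_analysis.
Set Implicit Arguments.
Unset Strict Implicit.
Unset Printing Implicit Defensive.
Import Order.TTheory GRing.Theory Num.Theory.
Local Open Scope classical_set_scope.
Local Open Scope ring_scope.

(* The feasible points are stored with real values (z = y composed with the
   cast from nat), so that their convex hull can be taken in R -> R. *)
Definition group_solutions (R : realType) (f : R) : set (R -> R) :=
  [set z | exists y : R -> nat,
    [/\ finite_set [set r | y r != 0%N],
        \sum_(r \in [set: R]) r * (y r)%:R - f \is a Num.int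
      & z = (fun r => (y r)%:R)]].

Definition group_relaxation (R : realType) (f : R) : set (R -> R) :=
  smallest (@convex_set R (R -> R)) (group_solutions f).

(* Every element of [group_relaxation f] has finite support, so the sum is a
   genuine finite sum and never the default value 0 of an infinite one. *)
Definition valid_function (R : realType) (f : R) (phi : R -> R) : Prop :=
  (forall r, 0 <= phi r) /\
  (forall z, group_relaxation f z ->
     1 <= \sum_(r \in [set: R]) phi r * z r).

Definition extreme_function (R : realType) (f : R) (phi : R -> R) : Prop :=
  valid_function f phi /\
  (forall phi1 phi2 : R -> R,
     valid_function f phi1 -> valid_function f phi2 ->
     phi = (fun r => 1 / 2 * (phi1 r + phi2 r)) ->
     phi = phi1 /\ phi = phi2).

(* Meaningful only for x in [0, 1]. *)
Definition pi_on_unit (R : realType) (f x : R) : R :=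
  if x <= f then 1 / f * x
  else if x < (1 + f) / 2 then 2 / (1 + 2 * f) * x
  else if x == (1 + f) / 2 then 1 / 2
  else if x < 1 then 2 / (1 + 2 * f) * x - 1 / (1 + 2 * f)
  else 0.

(* The values prescribed at 0 and 1 agree, so a 1-periodic function with the
   prescribed values on [0, 1] exists. *)
Lemma pi_on_unit_periodic_ext (R : realType) (f : R) : 0 < f < 1 ->
  exists phi : R -> R, periodic phi 1 /\
    forall x, 0 <= x <= 1 -> phi x = pi_on_unit f x.
Proof.
move=> /andP[f0 f1].
exists (fun x => pi_on_unit f (x - (Num.floor x)%:~R)); split.
  move=> x; congr pi_on_unit.
  by rewrite floorDrz ?rpred1// floor1 intrD opprD addrACA subrr addr0.
move=> x /andP[x0]; rewrite le_eqVlt => /orP[/eqP->|x1].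
  rewrite floor1 subrr /pi_on_unit ltW// mulr0.
  have h : (1 + f) / 2 < 1 by rewrite addrC midf_lt.
  by rewrite leNgt f1 /= ltNge (ltW h) /= gt_eqF//= ltxx.
suff -> : Num.floor x = 0 by rewrite subr0.
by apply/eqP; rewrite floor_eq ?num_real// x0 add0r.
Qed.

(* Main.v *)
Require Import Defs.
From HB Require Import structures.
From mathcomp Require Import all_boot all_order all_algebra.
From mathcomp Require Import all_classical all_reals all_analysis.
From mathcomp Require Import ring lra.
Import Order.TTheory GRing.Theory Num.Theory.
Local Open Scope classical_set_scope.
Local Open Scope ring_scope.

(** Write m = (1 + f) / 2 and let phi be the periodic function under study.

    Validity. On [0, 1) one has (1 + 2 f) phi(x) = 2 x + q(x), where q is the
    step-like function [excess]: it is x / f on [0, f], then 0 up to m, -1/2 at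
    m and -1 beyond. Once the linear part is removed, subadditivity of phi
    becomes the two inequalities q(x + y) <= q(x) + q(y) for x + y < 1 and
    q(x + y - 1) <= q(x) + q(y) + 2 for x + y >= 1. Both follow from -1 <= q <= 1
    and from the signs of q: nonnegative before m, nonpositive after f. A nonnegative subadditive
    function that vanishes at 0 and equals 1 on f + Z is valid.

    Extremality. Let phi be the mean of two valid functions. Apart from being
    subadditive, phi is symmetric: phi(x) + phi(f - x) = 1 ([phi_sym]). If x and
    y satisfy phi(x + y) = phi(x) + phi(y), the solutions {x, y, f - x - y} and
    {x + y, f - x - y} have phi-cost exactly 1, so both valid functions have
    cost 1 on them as well, and subtracting shows that they inherit the additive
    relation ([tight_add]); they inherit the symmetry in the same way
    ([tight_sym]). Hence d = psi - phi, for either summand psi, is a bounded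
    function with d(x) + d(f - x) = 0 that is additive wherever phi is, and
    [perturbation_eq0] says that such a d is 0:
    - phi is linear on [0, f] and d(f) = 0, so a bounded additive d vanishes
      there ([additive_bounded_eq0]);
    - for x, y > m with x + y < 1 + m the value x + y - 1 lies in (f, m) and phi
      is additive at (x, y); so d(x) + d(y) depends only on x + y, and a bounded
      d with this property is affine on (m, 1), d(m + a) = alpha + beta a
      ([pexider_bounded_affine]); by symmetry d(m - a) = - (alpha + beta a);
    - comparing constants in d(x) + d(y) = d(x + y - 1) gives
      3 alpha + beta L = 0, where L = m - f = 1 - m, and comparing them in
      d(x) + d(y) = d(x + y) for x, y, x + y in (f, m) gives
      alpha + beta L + beta f = 0. The second relation has instances exactly
      because 2 f < m, that is f < 1/3. Together they force alpha = beta = 0. *)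

(** * Valid functions and finite lists *)

(** A finite list, viewed as the function counting its entries, turns a sum
    over all reals into an ordinary list sum. *)
Lemma fsum_count_mem {R : realType} (g : R -> R) (s : seq R) :
  \sum_(r \in [set: R]) g r * (count_mem r s)%:R = \sum_(r <- s) g r.
Proof.
rewrite -(big_undup_iterop_count +%R s xpredT g).
rewrite (fsbigE (undup s)) ?undup_uniq//; last first.
  by move=> r _ /=; rewrite mem_undup => /count_memPn ->; rewrite mulr0.
by apply: eq_big => [r|r _]; rewrite ?in_setT// mulr_natr.
Qed.

(** Feasible points are used as lists of reals, repetitions allowed, whose sum
    is congruent to f. *)
Lemma valid_function_seq {R : realType} (f : R) (psi : R -> R) (s : seq R) :
  valid_function f psi -> \sum_(r <- s) r - f \is a Num.int ->
  1 <= \sum_(r <- s) psi r.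
Proof.
move=> [_ vpsi] sf; rewrite -fsum_count_mem; apply: vpsi.
apply: sub_gen_smallest; exists (fun r => count_mem r s); split => //.
  apply: (@sub_finite_set _ _ [set` s]); last exact: finite_seq.
  by move=> r /=; rewrite -lt0n -has_count has_pred1.
by rewrite fsum_count_mem.
Qed.

Lemma fsum_supp {R : realType} (phi z : R -> R) (A : set R) :
  [set r | z r != 0] `<=` A ->
  \sum_(r \in [set: R]) phi r * z r = \sum_(r \in A) phi r * z r.
Proof.
move=> zA; rewrite -(fsbig_widen A [set: R])// => r [_ Ar] /=.
by have [->|/zA//] := eqVneq (z r) 0; rewrite mulr0.
Qed.

(** Subadditivity gives phi(sum of r y(r)) <= sum of phi(r) y(r) at the feasible
    points. The inequality then passes to the convex hull, provided that finite
    support is carried along: a sum with infinite support would be 0. *)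
Lemma subadditive_valid {R : realType} (f : R) (phi : R -> R) :
  (forall r, 0 <= phi r) -> phi 0 = 0 ->
  (forall x y, phi (x + y) <= phi x + phi y) ->
  (forall x, x - f \is a Num.int -> phi x = 1) ->
  valid_function f phi.
Proof.
move=> phi_ge0 phi_at0 subadd phif; split => // z.
pose C := [set z : R -> R | finite_set [set r | z r != 0] /\
  1 <= \sum_(r \in [set: R]) phi r * z r].
have phiM n x : phi (x * n%:R) <= phi x * n%:R.
  elim: n => [|n IH]; first by rewrite !mulr0 phi_at0.
  by rewrite -natr1 !mulrDr !mulr1 (le_trans (subadd _ _))// lerD2r.
suff: group_relaxation f `<=` C by move=> /[apply] -[].
apply: smallest_sub.
  move=> x y l /set_mem[finx x1] /set_mem[finy y1]; apply/mem_set.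
  pose A := [set r | x r != 0] `|` [set r | y r != 0].
  have finA : finite_set A by rewrite finite_setU.
  have suppA : [set r | conv l x y r != 0] `<=` A.
    move=> r /=; apply: contraPP => /not_orP[/negP/negPn/eqP xr /negP/negPn/eqP yr].
    apply/negP/negPn/eqP.
    transitivity (l%:num * x r + (1 - l%:num) * y r); first by [].
    by rewrite xr yr !mulr0 addr0.
  split; first exact: sub_finite_set finA.
  move: x1 y1; rewrite !(@fsum_supp _ _ _ A)//; [|by right|by left].
  move=> x1 y1.
  have -> : \sum_(i \in A) phi i * (conv l x y) i =
      l%:num * (\sum_(i \in A) phi i * x i) +
      (1 - l%:num) * (\sum_(i \in A) phi i * y i).
    rewrite !fsbig_finite// !mulr_sumr -big_split; apply: eq_bigr => r _ /=.
    transitivity (phi r * (l%:num * x r + (1 - l%:num) * y r)); first by [].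
    by ring.
  have l0 : 0 <= l%:num :> R by [].
  have l1 : l%:num <= 1 :> R by [].
  by nra.
move=> _ [y [finy sumy ->]]; pose A := [set r | y r != 0%N].
have suppA : [set r | (y r)%:R != 0 :> R] `<=` A.
  by move=> r /=; rewrite pnatr_eq0.
split; first exact: sub_finite_set finy.
move: sumy; rewrite !(@fsum_supp _ _ _ A)// !fsbig_finite//= => /phif {1}<-.
elim: (finmap.enum_fset _) => [|r s IH]; first by rewrite !big_nil phi_at0.
by rewrite !big_cons (le_trans (subadd _ _))// lerD ?phiM.
Qed.

(** * Reduction modulo 1 *)

Lemma periodic_int {R : realType} {phi : R -> R} : periodic phi 1 ->
  forall x k, k \is a Num.int -> phi (x + k) = phi x.
Proof.
move=> per x k /intrP[[n|n] ->].
  by rewrite -[LHS]/(phi (x + 1 *+ n)) periodicn.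
by rewrite NegzE mulrNz -[LHS](periodicn per n.+1) subrK.
Qed.

Lemma exists_int_shift {R : realType} (x : R) :
  exists2 k, k \is a Num.int & 0 <= x - k < 1.
Proof.
exists (Num.floor x)%:~R; first by rewrite rpred_int_num.
by have := floor_itv x; rewrite intrD mulr1z; lra.
Qed.

(** * Bounded additive functions on an interval *)

(** As E(T) = 0, a point u can be doubled modulo T: the value 2 E(u) is again
    taken by E on [0, T]. Repeated doubling would leave any bound unless
    E(u) = 0. *)
Lemma additive_bounded_eq0 {R : realType} (E : R -> R) (T M : R) :
  (forall t, 0 <= t <= T -> `|E t| <= M) ->
  (forall s t, 0 <= s -> 0 <= t -> s + t <= T -> E (s + t) = E s + E t) ->
  E T = 0 -> forall t, 0 <= t <= T -> E t = 0.
Proof.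
move=> bdE addE ET t tT.
have dbl u : 0 <= u <= T -> exists2 v, 0 <= v <= T & E v = 2 * E u.
  move=> uT; have [u2|u2] := leP (u + u) T.
    by exists (u + u); [lra|rewrite addE; lra].
  have E2 : E (T / 2) + E (T / 2) = 0.
    by rewrite -addE -?splitr //; lra.
  have Eu : E u = E (u - T / 2) + E (T / 2).
    by rewrite -addE ?subrK //; lra.
  exists ((u - T / 2) + (u - T / 2)); first by lra.
  by rewrite addE; lra.
(* Only n + 1 <= 2 n is used of the doubling, which fails at n = 0; there the
   bound on E itself applies. *)
have bnd n : forall u, 0 <= u <= T -> n%:R * `|E u| <= M.
  elim: n => [u uT|n IH u uT]; first by rewrite mul0r (le_trans _ (bdE u uT)).
  have [v vT Ev] := dbl u uT.
  have := IH v vT; have := bdE u uT; rewrite Ev normrM ger0_norm// -natr1.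
  case: n {IH} => [|n]; first by lra.
  by rewrite -natr1; have := ler0n R n; have := normr_ge0 (E u); nra.
apply/eqP/negPn/negP => Et.
have Et0 : 0 < `|E t| by rewrite normr_gt0.
have := bnd (Num.trunc (M / `|E t|)).+1 t tT.
by rewrite -ler_pdivlMr // leNgt truncnS_gt.
Qed.

Lemma additive_bounded_linear {R : realType} (E : R -> R) (T M : R) :
  0 < T -> (forall t, 0 <= t <= T -> `|E t| <= M) ->
  (forall s t, 0 <= s -> 0 <= t -> s + t <= T -> E (s + t) = E s + E t) ->
  forall t, 0 <= t <= T -> E t = E T / T * t.
Proof.
move=> T0 bdE addE t tT; apply/eqP; rewrite -subr_eq0; apply/eqP.
pose E' u := E u - E T / T * u.
apply: (@additive_bounded_eq0 R E' T (M + `|E T / T| * T) _ _ _ t tT).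
- move=> u uT; rewrite (le_trans (ler_normB _ _))// lerD ?bdE// normrM.
  by rewrite ler_wpM2l// ger0_norm; lra.
- by move=> u v u0 v0 uv; rewrite /E' addE//; ring.
- by rewrite /E' divfK ?subrr// gt_eqF.
Qed.

(** If G(a) + G(b) depends only on a + b, the increment G(a + t) - G(a) does not
    depend on a. It is additive and bounded as a function of t, hence linear. *)
Lemma pexider_bounded_affine {R : realType} (G : R -> R) (L M : R) :
  0 < L -> (forall a, 0 < a < L -> `|G a| <= M) ->
  (forall a b a' b', 0 < a -> 0 < b -> 0 < a' -> 0 < b' ->
     a + b = a' + b' -> a + b < L -> G a + G b = G a' + G b') ->
  exists alpha beta, forall a, 0 < a < L -> G a = alpha + beta * a.
Proof.
move=> L0 bdG HG.
(* The increment over t, read off in the middle of (0, L) so that both end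
   points are interior. *)
pose D t := G ((L + t) / 2) - G ((L - t) / 2).
have DE a t : 0 < a -> 0 <= t -> a + t < L -> G (a + t) - G a = D t.
  move=> a0 t0 atL.
  pose b := Num.min (L - a - t) ((L - t) / 2) / 2.
  have [b0 b1 b2] : [/\ 0 < b, a + t + b < L & (L + t) / 2 + b < L].
    by rewrite /b; case: (leP (L - a - t) ((L - t) / 2)) => h; split; lra.
  have h1 : G (a + t) + G b = G a + G (b + t) by apply: HG; lra.
  have h2 : G ((L + t) / 2) + G b = G ((L - t) / 2) + G (b + t).
    by apply: HG; lra.
  by rewrite /D; lra.
have addD s t : 0 <= s -> 0 <= t -> s + t < L -> D (s + t) = D s + D t.
  move=> s0 t0 stL; pose a := (L - (s + t)) / 2.
  rewrite -(DE a (s + t)) -?(DE (a + s) t) -?(DE a s) ?addrA; rewrite /a; lra.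
pose beta := D (L / 2) / (L / 2).
(* D is known to be additive below L only, so linearity is proved on [0, L / 2] and reaches
   [0, L) by halving. *)
have Dhalf t : 0 <= t <= L / 2 -> D t = beta * t.
  move=> tL; apply: (@additive_bounded_linear R D (L / 2) (M + M)) => //; first lra.
    by move=> u uL; rewrite (le_trans (ler_normB _ _))// lerD// bdG//; lra.
  by move=> u v *; apply: addD; lra.
have Dlin t : 0 <= t < L -> D t = beta * t.
  move=> tL; rewrite [in LHS](splitr t) addD ?Dhalf; lra.
exists (G (L / 2) - beta * (L / 2)), beta => a aL.
have [ha|ha] := leP a (L / 2).
  have := DE a (L / 2 - a); rewrite subrKC Dlin; lra.
have := DE (L / 2) (a - L / 2); rewrite subrKC Dlin; lra.
Qed.

(** * Relations inherited by the summands of a mean *)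

(** Both summands cost at least 1 on a feasible list, so if their mean costs
    exactly 1 then so do they. *)
Lemma tight_seq {R : realType} (f : R) (phi psi1 psi2 : R -> R) (s : seq R) :
  valid_function f psi1 -> valid_function f psi2 ->
  phi = (fun r => 1 / 2 * (psi1 r + psi2 r)) ->
  \sum_(r <- s) r - f \is a Num.int ->
  \sum_(r <- s) phi r = 1 -> \sum_(r <- s) psi1 r = 1.
Proof.
move=> v1 v2 -> sf; have := valid_function_seq _ _ _ v1 sf.
have := valid_function_seq _ _ _ v2 sf.
rewrite -mulr_sumr big_split /=; lra.
Qed.

Lemma tight_sym {R : realType} (f : R) (phi psi1 psi2 : R -> R) :
  valid_function f psi1 -> valid_function f psi2 ->
  phi = (fun r => 1 / 2 * (psi1 r + psi2 r)) ->
  (forall x, phi x + phi (f - x) = 1) ->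
  forall x, psi1 x + psi1 (f - x) = 1.
Proof.
move=> v1 v2 avg sym x; have := @tight_seq _ f _ _ _ [:: x; f - x] v1 v2 avg.
rewrite !big_cons !big_nil !addr0; apply => //.
by rewrite subrKC subrr.
Qed.

(** The lists [x; y; f - (x + y)] and [x + y; f - (x + y)] are both tight. *)
Lemma tight_add {R : realType} (f : R) (phi psi1 psi2 : R -> R) :
  valid_function f psi1 -> valid_function f psi2 ->
  phi = (fun r => 1 / 2 * (psi1 r + psi2 r)) ->
  (forall x, phi x + phi (f - x) = 1) ->
  forall x y, phi (x + y) = phi x + phi y -> psi1 (x + y) = psi1 x + psi1 y.
Proof.
move=> v1 v2 avg sym x y xy.
have := @tight_seq _ f _ _ _ [:: x; y; f - (x + y)] v1 v2 avg.
rewrite !big_cons !big_nil !addr0 !addrA -xy sym => /(_ _ erefl).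
rewrite [x + y + f]addrC addrK subrr => /(_ (rpred0 _)).
have := @tight_sym _ f _ _ _ v1 v2 avg sym (x + y); lra.
Qed.

(** * Subadditivity and symmetry of the function *)

(** What remains of (1 + 2 f) phi on [0, 1) once its common slope 2 is
    subtracted. *)
Definition excess {R : realType} (f x : R) : R :=
  if x <= f then x / f else
  if x < (1 + f) / 2 then 0 else if x == (1 + f) / 2 then - (1 / 2) else - 1.

(** The value on [0, f] is named w and bounded, so that the case analyses below
    are linear in x, y and w although x / f is not linear in the data. *)
Variant excess_spec {R : realType} (f x : R) : R -> Type :=
| ExcessLeft : x <= f -> forall w, w = x / f -> (0 <= x -> 0 <= w <= 1) ->
    excess_spec f x w
| ExcessLow : f < x -> x < (1 + f) / 2 -> excess_spec f x 0
| ExcessMid : x = (1 + f) / 2 -> excess_spec f x (- (1 / 2))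
| ExcessHigh : (1 + f) / 2 < x -> excess_spec f x (- 1).

Lemma excessP {R : realType} (f x : R) : 0 < f < 1 / 3 -> excess_spec f x (excess f x).
Proof.
move=> hf; have f0 : 0 < f by lra.
rewrite /excess; case: (leP x f) => xf.
  by apply: ExcessLeft => // x0; rewrite divr_ge0 ?ler_pdivrMr ?mul1r//; lra.
by case: (ltgtP x ((1 + f) / 2)) => xm; constructor.
Qed.

Lemma phi_excess {R : realType} (f : R) (phi : R -> R) : 0 < f < 1 / 3 ->
  (forall x, 0 <= x <= 1 -> phi x = pi_on_unit f x) ->
  forall x, 0 <= x < 1 -> phi x = (2 * x + excess f x) / (1 + 2 * f).
Proof.
move=> hf phi_unit x x01; rewrite phi_unit; last lra.
rewrite /pi_on_unit /excess; case: (leP x f) => xf; first by field; lra.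
case: (ltgtP x ((1 + f) / 2)) => xm; first by rewrite addr0 mulrAC.
  by case: ltP => x1; [field|]; lra.
by rewrite xm; field; lra.
Qed.

Lemma excess0 {R : realType} (f : R) : 0 < f < 1 / 3 -> excess f 0 = 0.
Proof. by move=> hf; rewrite /excess mul0r; case: ifP => //; lra. Qed.

Lemma phi_at0 {R : realType} (f : R) (phi : R -> R) : 0 < f < 1 / 3 ->
  (forall x, 0 <= x <= 1 -> phi x = pi_on_unit f x) -> phi 0 = 0.
Proof.
move=> hf phi_unit.
by rewrite (@phi_excess _ f) ?excess0 ?mulr0 ?addr0 ?mul0r//; lra.
Qed.

Lemma phi_ge0 {R : realType} (f : R) (phi : R -> R) : 0 < f < 1 / 3 -> periodic phi 1 ->
  (forall x, 0 <= x <= 1 -> phi x = pi_on_unit f x) -> forall x, 0 <= phi x.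
Proof.
move=> hf phi_periodic phi_unit x; have [k kint kx] := @exists_int_shift _ x.
rewrite -[x](subrK k) periodic_int// (@phi_excess _ f)// divr_ge0//; last by lra.
by case: (excessP _ (x - k) hf) => [_ w _|||]; lra.
Qed.

(** Subadditivity of phi at x, y without wrapping around; the linear parts
    cancel. Beyond f the left-hand side is at most 0, and the right-hand side is
    negative only if one of x, y is at least m. In that case the other one lies
    before m, and unless it is 0 the sum is beyond m, where the excess is -1. *)
Lemma excess_subadd {R : realType} {f x y : R} : 0 < f < 1 / 3 ->
  0 <= x < 1 -> 0 <= y < 1 -> x + y < 1 ->
  excess f (x + y) <= excess f x + excess f y.
Proof.
move=> hf x0 y0 xy1.
have [->|x_neq0] := eqVneq x 0; first by rewrite excess0// !add0r.
have [->|y_neq0] := eqVneq y 0; first by rewrite excess0// !addr0.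
have {x_neq0 y_neq0} [x_gt0 y_gt0] : 0 < x /\ 0 < y.
  by rewrite !lt_def x_neq0 y_neq0; split; lra.
case: (excessP _ (x + y) hf) => [xyf w -> _|xyf xym|xym|xym].
- by rewrite /excess !ifT ?mulrDl//; lra.
- by case: (excessP _ x hf) => [? ? _|||]; case: (excessP _ y hf) => [? ? _|||]; lra.
- by case: (excessP _ x hf) => [? ? _|||]; case: (excessP _ y hf) => [? ? _|||]; lra.
- by case: (excessP _ x hf) => [? ? _|||]; case: (excessP _ y hf) => [? ? _|||]; lra.
Qed.

(** Subadditivity of phi at x, y when x + y wraps around 1: the linear part of
    the sum drops by 2. If x or y is before m, the right-hand side is at least 1.
    Otherwise x + y - 1 >= f, with equality only for x = y = m, where both sides
    are 1; beyond f the left-hand side is at most 0. *)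
Lemma excess_subadd1 {R : realType} {f x y : R} : 0 < f < 1 / 3 ->
  0 <= x < 1 -> 0 <= y < 1 -> 1 <= x + y ->
  excess f (x + y - 1) <= excess f x + excess f y + 2.
Proof.
move=> hf x0 y0 xy1.
by case: (excessP _ (x + y - 1) hf) => [? ? _|||];
  case: (excessP _ x hf) => [? ? _|||]; case: (excessP _ y hf) => [? ? _|||]; lra.
Qed.

Lemma phi_subadd {R : realType} (f : R) (phi : R -> R) : 0 < f < 1 / 3 ->
  periodic phi 1 -> (forall x, 0 <= x <= 1 -> phi x = pi_on_unit f x) ->
  forall x y, phi (x + y) <= phi x + phi y.
Proof.
move=> hf per unit x y.
have [k kint kx] := exists_int_shift x; have [l lint ly] := exists_int_shift y.
have kl : k + l \is a Num.int by rewrite rpredD.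
rewrite -[in leRHS](subrK k x) -[in leRHS](subrK l y).
rewrite !(periodic_int per _ _ kint, periodic_int per _ _ lint).
rewrite -(subrK (k + l) (x + y)) (periodic_int per _ _ kl) opprD addrACA.
move: (x - k) (y - l) kx ly => u v u01 v01 {x y k l kint lint kl}.
have E := @phi_excess _ f phi hf unit.
have f0 : 0 < 1 + 2 * f by lra.
rewrite (E u)// (E v)//; have [uv|uv] := leP 1 (u + v); last first.
  rewrite E; last lra.
  rewrite -mulrDl ler_pM2r ?invr_gt0//.
  by have := excess_subadd hf u01 v01 uv; lra.
rewrite -(subrK 1 (u + v)) (per (u + v - 1)) E; last lra.
rewrite -mulrDl ler_pM2r ?invr_gt0//.
by have := excess_subadd1 hf u01 v01 uv; lra.
Qed.

Lemma phi_sym {R : realType} (f : R) (phi : R -> R) : 0 < f < 1 / 3 ->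
  periodic phi 1 -> (forall x, 0 <= x <= 1 -> phi x = pi_on_unit f x) ->
  forall x, phi x + phi (f - x) = 1.
Proof.
move=> hf per unit x.
have [k kint kx] := exists_int_shift x.
have E := @phi_excess _ f phi hf unit.
rewrite -(periodic_int per (f - x) _ kint) -[in phi x](subrK k x).
rewrite (periodic_int per (x - k) _ kint).
have -> : f - x + k = f - (x - k) by lra.
move: (x - k) kx => u u01 {x k kint}.
rewrite (E u)//; have [uf|uf] := leP u f.
  rewrite E; last lra.
  by rewrite /excess uf gerBl (andP u01).1; field; lra.
rewrite -(per (f - u)) E; last lra.
rewrite -mulrDl; apply/eqP; rewrite -[X in _ == X](@divff _ (1 + 2 * f)); last lra.
apply/eqP; congr (_ / _).
case: (excessP _ u hf) => [? ? _|||];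
  case: (excessP _ (f - u + 1) hf) => [? ? _|||]; lra.
Qed.

(** * Rigidity of perturbations *)

Lemma phi_low {R : realType} (f : R) (phi : R -> R) : 0 < f < 1 / 3 ->
  (forall x, 0 <= x <= 1 -> phi x = pi_on_unit f x) ->
  forall x, f < x < (1 + f) / 2 -> phi x = 2 * x / (1 + 2 * f).
Proof.
move=> hf unit x xI; rewrite (@phi_excess _ f)//; last lra.
by case: (excessP _ x hf) => [? ? _|||]; rewrite ?addr0; lra.
Qed.

Lemma phi_high {R : realType} (f : R) (phi : R -> R) : 0 < f < 1 / 3 ->
  (forall x, 0 <= x <= 1 -> phi x = pi_on_unit f x) ->
  forall x, (1 + f) / 2 < x < 1 -> phi x = (2 * x - 1) / (1 + 2 * f).
Proof.
move=> hf unit x xI; rewrite (@phi_excess _ f)//; last lra.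
by case: (excessP _ x hf) => [? ? _|||]; lra.
Qed.

(** A bounded d that inherits the periodicity, the (homogeneous) symmetry and
    every additive relation of phi vanishes. It is affine to the right of m, and
    the remaining relations determine the two coefficients. *)
Lemma perturbation_eq0 {R : realType} (f : R) (phi d : R -> R) (M : R) :
  0 < f < 1 / 3 ->
  periodic phi 1 -> (forall x, 0 <= x <= 1 -> phi x = pi_on_unit f x) ->
  periodic d 1 -> (forall x, `|d x| <= M) ->
  (forall x, d x + d (f - x) = 0) ->
  (forall x y, phi (x + y) = phi x + phi y -> d (x + y) = d x + d y) ->
  forall x, d x = 0.
Proof.
move=> hf phiper unit dper bdd dsym dadd.
have d0 : d 0 = 0.
  have := dadd 0 0; rewrite addr0 (@phi_at0 _ f)// addr0 => /(_ erefl); lra.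
have df : d f = 0 by have := dsym 0; rewrite subr0; lra.
have dleft : forall x, 0 <= x <= f -> d x = 0.
  apply: (@additive_bounded_eq0 _ d f M) => // s t s0 t0 st.
  apply: dadd; rewrite !unit; try lra.
  by rewrite /pi_on_unit !ifT; lra.
have [m mE] : exists m, m = (1 + f) / 2 by exists ((1 + f) / 2).
have [L LE] : exists L, L = (1 - f) / 2 by exists ((1 - f) / 2).
have phi_lowE x : f < x < m -> phi x = 2 * x / (1 + 2 * f).
  by rewrite mE; exact: phi_low.
have phi_highE x : m < x < 1 -> phi x = (2 * x - 1) / (1 + 2 * f).
  by rewrite mE; exact: phi_high.
(* Additivity of phi on (m, 1), where the sum wraps around into (f, m). *)
have dJJ a b : 0 < a -> 0 < b -> a + b < L ->
    d (m + a) + d (m + b) = d (f + (a + b)).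
  move=> a0 b0 ab.
  have shift : m + a + (m + b) = f + (a + b) + 1 by lra.
  rewrite -dadd shift ?dper// phiper phi_lowE ?phi_highE -?mulrDl; try lra.
  by congr (_ / _); lra.
have [|||alpha [beta dhigh]] := @pexider_bounded_affine _ (fun a => d (m + a)) L M.
- lra.
- by move=> a _; exact: bdd.
- by move=> a b a' b' a0 b0 a'0 b'0 ab abL; rewrite !dJJ// -?ab.
have dlow a : 0 < a < L -> d (m - a) = - (alpha + beta * a).
  move=> aL; have := dsym (m - a).
  have -> : f - (m - a) = m + a - 1 by lra.
  have -> : d (m + a - 1) = d (m + a) by rewrite -dper subrK.
  by rewrite (dhigh a)//; lra.
(* One instance of dJJ: the arguments m + L / 4 sum to 1 + (m - L / 2). *)
have e1 : 3 * alpha + beta * L = 0.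
  have := dJJ (L / 4) (L / 4).
  have -> : f + (L / 4 + L / 4) = m - L / 2 by lra.
  by rewrite dlow ?dhigh; lra.
(* One instance of additivity inside (f, m), at f + u = m - (L - u) taken twice;
   the choice of u > 0 keeps 2 f + 2 u below m. *)
have e2 : alpha + beta * L + beta * f = 0.
  have [u uE] : exists u, u = (L - f) / 4 by exists ((L - f) / 4).
  have : d (m - (L - u) + (m - (L - u))) = d (m - (L - u)) + d (m - (L - u)).
    by apply: dadd; rewrite !phi_lowE; lra.
  have -> : m - (L - u) + (m - (L - u)) = m - (L - f - u - u) by lra.
  by rewrite !dlow; lra.
have beta0 : beta = 0.
  have : beta * (L * 2 / 3 + f) = 0 by lra.
  by move/eqP; rewrite mulf_eq0 => /orP[/eqP//|]; lra.
have alpha0 : alpha = 0 by move: e1; rewrite beta0; lra.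
have d01 x : 0 <= x < 1 -> d x = 0.
  move=> x01; have [xf|xf] := leP x f; first by apply: dleft; lra.
  have [xm|xm|xm] := ltgtP x m.
  - have := dlow (m - x); rewrite subKr alpha0 beta0; lra.
  - have := dhigh (x - m); rewrite subrKC alpha0 beta0; lra.
  have := dsym x; have <- : d (f - x + 1) = d (f - x) by exact: dper.
  have -> : f - x + 1 = x by lra.
  lra.
move=> x; have [k kint kx] := exists_int_shift x.
by rewrite -(subrK k x) (periodic_int dper _ _ kint) d01.
Qed.

Theorem theorem2p1 (R : realType) (f : R) (hf : 0 < f < 1 / 3)
    (phi : R -> R) (phi_periodic : periodic phi 1)
    (phi_unit : forall x : R, 0 <= x <= 1 -> phi x = pi_on_unit f x) :
  extreme_function f phi.
Proof.
have sym := @phi_sym _ f phi hf phi_periodic phi_unit.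
have pos := @phi_ge0 _ f phi hf phi_periodic phi_unit.
have phi_0 := @phi_at0 _ f phi hf phi_unit.
have phi_f : phi f = 1 by have := sym f; rewrite subrr phi_0 addr0.
have phi_1 : phi 1 = 0 by have := phi_periodic 0; rewrite add0r phi_0.
have key psi1 psi2 : valid_function f psi1 -> valid_function f psi2 ->
    phi = (fun r => 1 / 2 * (psi1 r + psi2 r)) -> phi = psi1.
  move=> v1 v2 avg.
  have psisym := @tight_sym _ f phi psi1 psi2 v1 v2 avg sym.
  have psiadd := @tight_add _ f phi psi1 psi2 v1 v2 avg sym.
  have psi0 : forall x, 0 <= psi1 x := v1.1.
  (* Additivity at (-1, 1) gives psi1 (-1) + psi1 1 = 0, and both are
     nonnegative. *)
  have psi1_1 : psi1 1 = 0.
    have h0 : psi1 0 = 0.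
      by have := psiadd 0 0; rewrite addr0 phi_0 addr0 => /(_ erefl); lra.
    have := psiadd (- 1) 1; rewrite addNr h0 phi_0 phi_1 -[phi (- 1)]phi_periodic.
    rewrite addNr phi_0 addr0.
    move=> /(_ erefl); have := psi0 1; have := psi0 (- 1); lra.
  apply/funext => x; apply/esym/eqP; rewrite -subr_eq0; apply/eqP; move: x.
  apply: (@perturbation_eq0 _ f phi (fun x => psi1 x - phi x) 1) => //.
  - by move=> x; rewrite phi_periodic psiadd ?psi1_1 ?addr0// phi_periodic phi_1 addr0.
  - move=> x; rewrite ler_norml; have := psi0 x; have := pos x; have := sym x.
    have := psisym x; have := psi0 (f - x); have := pos (f - x); lra.
  - by move=> x; have := sym x; have := psisym x; lra.
  - by move=> x y xy; rewrite (psiadd _ _ xy) xy; lra.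
split.
  apply: subadditive_valid => //; first exact: phi_subadd hf _ _.
  by move=> x xf; rewrite -phi_f -[x](subrKC f) periodic_int.
move=> psi1 psi2 v1 v2 avg; split; first exact: key v1 v2 avg.
by apply: key v2 v1 _; rewrite avg; apply/funext => r; rewrite addrC.
Qed.
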